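(* Let $(\mathcal F_n,\int^{x_n})$ be a Rota-Baxter hierarchy over a field $K$ and let $\mathcal G$ be an admissible coefficient domain for $\mathcal F$. Let $M\in\mathcal M_n(K)$, $j\in\{1,\dots,n\}$ and $g\in\mathcal G_1$, and put $i:=\min\{k\mid M_{kj}\ne0\}$ (with $i=\infty$ if the $j$-th column of $M$ is zero). Then, as operators on $\mathcal F$, $$\int^{x_j}g(x_j)\,M^*=\begin{cases}M_{ij}^{-1}\,\gamma'_\mu\,(1-E_j^* )\,\tilde M^*\int^{x_i}\gamma[d_{j,1/M_{ij}}][i\;j]_\mu\,L_i(l)^*&\text{if }i\ne\infty,\\[3pt]\big(\int^{x_j}g(x_j)\big)M^*&\text{otherwise,}\end{cases}$$ with summation over $\mu$ implied. Here, if $i\neq\infty$: $l=(l_{i+1},\dots,l_n)$ with $l_k:=M_{kj}/M_{ij}$; $\tilde M:=L_i(-l)\,M$; and $\gamma'=\tilde g\{j\}'$, $\gamma=\tilde g\{j\}$ for $$\tilde g=g\big[-\tfrac{M_{i,1}}{M_{ij}},\dots,-\tfrac{M_{i,j-1}}{M_{ij}},\,1,\,-\tfrac{M_{i,j+1}}{M_{ij}},\dots,-\tfrac{M_{i,n}}{M_{ij}}\big]\in\mathcal G_n$$ (entry $1$ in position $j$).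
   Context: $K$ is a field of characteristic zero. All $K$-algebras are commutative and unital; all bialgebras are commutative and cocommutative. Rota-Baxter operators have weight zero: a linear operator $P$ with $P(u)P(v)=P(uP(v))+P(P(u)v)$. A Rota-Baxter algebra $(G,P)$ over a ring $R\supseteq\mathbb Q$ ($P$ being $R$-linear) is ordinary if $P$ is injective and $G=R\oplus\operatorname{im}P$ as $R$-modules; its associated evaluation is the projector onto $R$ along $\operatorname{im}P$. Matrices. $\mathcal M(K)$ is the monoid of infinite matrices (indexed by $1,2,\dots$) of the form $I+\tilde M$ with $\tilde M$ having finitely many nonzero rows and columns; $M\in\mathcal M_n(K)=K^{n\times n}$ is identified with $\mathrm{diag}(M,I)$. $\tilde{\mathcal M}_m(K)=\{\mathrm{diag}(I_m,M): M\in\mathcal M(K)\}$. $E_n:=I-e_{nn}$; $d_{i,\lambda}:=I+(\lambda-1)e_{ii}$. A scalar $\lambda$ is identified with $\mathrm{diag}(\lambda,1,1,\dots)$; a row $a=(a_1,\dots,a_n)$ is identified with the matrix having first row $a$ and all further rows equal to those of $I$. $T_1(e_1):=I+e_{12}$. For $w=(w_{i+1},\dots,w_n)^{\top}\in K^{n-i}$, $L_i(w):=I+\sum_{k>i}w_ke_{ki}$, so $L_i^{-1}(w)=L_i(-w)$; unit vectors $e_k\in K^{n-i}$ are numbered by position. For $M\in\mathcal M(K)$, $M_{\lrcorner n}$ has the same first $n$ rows as $M$ and further rows $e_{n+1},e_{n+2},\dots$. $K$-hierarchy. An ascending sequence of $K$-algebras $K=\mathcal F_0\subseteq\mathcal F_1\subseteq\cdots$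 with union $\mathcal F$, together with a contravariant monoid action of $\mathcal M(K)$ on $\mathcal F$ by $K$-algebra endomorphisms $M^*$ ($I^*=\mathrm{id}$, $(MN)^*=N^*M^*$) that is straight ($M^*f=M_{\lrcorner n}^*f$ for $f\in\mathcal F_n$) and satisfies $M^*(\mathcal F_n)\subseteq\mathcal F_n$ for $M\in\mathcal M_n(K)$ and $E_n^*(\mathcal F_n)\subseteq\mathcal F_{n-1}$. Rota-Baxter hierarchy. A $K$-hierarchy with commuting Rota-Baxter operators $\int^{x_n}:\mathcal F\to\mathcal F$ ($n\ge1$) such that: (a) for $n\le m$, $\int^{x_n}\mathcal F_m\subseteq\mathcal F_m$ and $\int^{x_n}M^*=M^*\int^{x_n}$ for all $M\in\tilde{\mathcal M}_m(K)$; (b) every $(\mathcal F_n,\int^{x_n})$ is an ordinary Rota-Baxter algebra over $\mathcal F_{n-1}$ with evaluation $E_n^*$; (c) $\tau^*\int^{x_i}=\int^{x_j}\tau^*$ for the transposition matrix $\tau=(i\;j)$; (d) for $\lambda\in K\setminus\{0\}$ and $v=(0,v')\in K\oplus K^{n-2}$: $\int^{x_1}\lambda^*=\lambda^{-1}\lambda^*\int^{x_1}$; $\int^{x_1}T_1(e_1)^*=(1-E_1^* )T_1(e_1)^*\int^{x_1}$; and $\int^{x_1}L_1(e_1+v)^*\int^{x_1}=L_2^{-1}(v')^*\,[L_1(e_1)^*,\int^{x_1}]\,\int^{x_2}L_2(v')^*$, where $[S,T]=ST-TS$. A Rota-Baxter subhierarchy consists of subalgebras $\mathcal G_n\subseteq\mathcal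 F_n$ forming a Rota-Baxter hierarchy under the restricted operators and the restricted matrix action. Scaled Rota-Baxter bialgebra. Let $(B,\Delta,\epsilon)$ be a $K$-bialgebra with product $\nabla$, unit $1$; put $\mathsf e:=1\circ\epsilon$ and $f\oplus g:=\nabla(f\otimes g)\Delta$ for linear endomorphisms. $(B,\Delta,\epsilon,\int)$ is a Rota-Baxter bialgebra if $(B,\int)$ is an ordinary Rota-Baxter algebra over $K$, $\mathsf e$ is the projector onto $K$ along $\operatorname{im}\int$, and $\Delta\int=(\int\otimes\mathrm{id})\Delta+(\mathsf e\otimes\mathrm{id})\Delta\int$. It is scaled if there is also a scaling $\lambda\mapsto\lambda^*$, i.e. a monoid homomorphism from $(K\setminus\{0\},\cdot)$ to bialgebra endomorphisms of $B$ such that, with $0^*:=\mathsf e$, $\lambda\mapsto\lambda^*$ is a semiring homomorphism $(K,+,\cdot)\to(\text{bialgebra endomorphisms},\oplus,\circ)$, and $\int\lambda^*=\lambda^{-1}\lambda^*\int$ for $\lambda\ne0$. Its induced Rota-Baxter hierarchy $\mathfrak H(B)$ has components $B_n=B^{\otimes n}$ (embedded in $B_{n+1}$ by $f\mapsto f\otimes1$), operators $\int^{x_n}=\mathrm{id}^{\otimes(n-1)}\otimes\int$, and matrix action $M^*(f_1\otimes\cdots\otimes f_n)=(M_{1\bullet}^*f_1)\cdots(M_{n\bullet}^*f_n)$, where $a^*:=(a_1^*\otimes\cdots\otimes a_n^* )\Delta^n:B\to B_n$ for a row $a$, and $\Delta^n$ is the iterated coproduct. Admissible coefficient domain. A Rota-Baxter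 hierarchy is separated if it is of the form $\mathfrak H(B)$ for a scaled Rota-Baxter bialgebra $B$. An admissible coefficient domain for $\mathcal F$ is a separated Rota-Baxter subhierarchy $\mathcal G=\mathfrak H(B)\le\mathcal F$; so $\mathcal G_1=B$, $\mathcal G_n=B^{\otimes n}$. Notation. $f[M]:=M^*(f)$, so $f[M][N]=f[MN]$; for a transposition, $f[i\;j]:=f[(i\;j)]$ (for $i=j$ this is $f$); $f[a]$ is used likewise for a row $a$. For $f\in\mathcal G_1$, $f(x_i):=(1\;i)^*f\in\mathcal G_{(i)}$, where $\mathcal G_{(i)}=(1\;i)^*\mathcal G_1$ is the algebra of functions of $x_i$ only. Elements $f\in\mathcal F$ also denote the multiplication operators $u\mapsto fu$, and juxtaposition in operator expressions is composition (so $M^*f$ is $u\mapsto M^*(fu)$); an expression such as $\big(\int^{x_j}g(x_j)\big)$ in parentheses is the function obtained by applying $\int^{x_j}$ to $g(x_j)$. Tensor expansion: every $g\in\mathcal G_n$ is written (via a fixed $K$-basis of $\mathcal G_1$, with scalars absorbed in one component) as $g=\sum_{\mu=1}^r\prod_{j=1}^n g\{j\}_\mu$ with $g\{j\}_\mu\in\mathcal G_{(j)}$. Put $g\{j\}'_\mu:=\prod_{k\in\{1,\dots,n\},\,k\ne j}g\{k\}_\mu$. For a sequence $\gamma$, $\gamma[M]$ is taken componentwise. Summation over repeated Greek indices is implied. *)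

(* Defs.v *)
From HB Require Import structures.
From mathcomp Require Import all_boot all_order all_algebra.
From mathcomp Require Import boolp classical_sets cardinality fsbigop.

Set Implicit Arguments.
Unset Strict Implicit.
Unset Printing Implicit Defensive.

Import GRing.Theory.
Local Open Scope quotient_scope.
Local Open Scope ring_scope.

(* Indices of variables, rows and columns are counted from 0: the nat i stands
   for the index usually written i + 1.  Ranks (the n of F_n, M_n(K), B^(x)n)
   are not shifted, so F_n is the algebra of functions of x_0, ..., x_(n-1). *)

(* Tensor powers of a K-algebra.  An element is a formal sum of terms
   c * (b_0 (x) ... (x) b_(n-1)); two formal sums are identified when no
   multilinear map into a K-module separates them, which is the universal
   property of the tensor power (tliftE and tpow_ind below).                   *)

Section TensorPower.
Variables (K : fieldType) (B : comAlgType K).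

Definition tset n (b : n.-tuple B) (i : 'I_n) (x : B) : n.-tuple B :=
  [tuple if k == i then x else tnth b k | k < n].

Definition multilinear n (V : lmodType K) (f : n.-tuple B -> V) : Prop :=
  forall (i : 'I_n) (b : n.-tuple B) (c : K) (x y : B),
    f (tset b i (c *: x + y)) = c *: f (tset b i x) + f (tset b i y).

Definition feval n (V : lmodType K) (f : n.-tuple B -> V)
    (s : seq (K * n.-tuple B)) : V := \sum_(p <- s) p.1 *: f p.2.

Definition teq n (s t : seq (K * n.-tuple B)) : bool :=
  `[< forall (V : lmodType K) (f : n.-tuple B -> V),
        multilinear f -> feval f s = feval f t >].

Fact teq_refl n : reflexive (@teq n).
Proof. by move=> s; apply/asboolP. Qed.

Fact teq_sym n : symmetric (@teq n).
Proof.
move=> s t; apply/idP/idP => /asboolP e; apply/asboolP => V f mf;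
by rewrite (e _ _ mf).
Qed.

Fact teq_trans n : transitive (@teq n).
Proof.
move=> t s u /asboolP e1 /asboolP e2; apply/asboolP => V f mf.
by rewrite (e1 _ _ mf) (e2 _ _ mf).
Qed.

Canonical teq_equiv n :=
  EquivRel (@teq n) (@teq_refl n) (@teq_sym n) (@teq_trans n).

Definition tpow (n : nat) : Type := {eq_quot (teq_equiv n)}.

HB.instance Definition _ n := Choice.on (tpow n).

Definition tcls n (s : seq (K * n.-tuple B)) : tpow n :=
  \pi_({eq_quot (teq_equiv n)}) s.
Definition trep n (x : tpow n) : seq (K * n.-tuple B) :=
  repr (x : {eq_quot (teq_equiv n)}).

Lemma trepK n (x : tpow n) : tcls (trep x) = x.
Proof. exact: reprK. Qed.

Lemma tclsP n (s t : seq (K * n.-tuple B)) :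
  tcls s = tcls t <->
  (forall (V : lmodType K) (f : n.-tuple B -> V),
     multilinear f -> feval f s = feval f t).
Proof.
split; first by move=> /eqP; rewrite /tcls eqmodE => /asboolP.
by move=> h; apply/eqP; rewrite /tcls eqmodE; apply/asboolP.
Qed.

Lemma feval_repr n (V : lmodType K) (f : n.-tuple B -> V)
    (s : seq (K * n.-tuple B)) :
  multilinear f -> feval f (trep (tcls s)) = feval f s.
Proof. by move=> mf; apply: (proj1 (tclsP _ _)) mf; exact: trepK. Qed.

Definition fscale n (c : K) (s : seq (K * n.-tuple B)) :=
  [seq (c * p.1, p.2) | p <- s].
Definition fmul n (s t : seq (K * n.-tuple B)) : seq (K * n.-tuple B) :=
  [seq (p.1 * q.1, [tuple tnth p.2 k * tnth q.2 k | k < n]) | p <- s, q <- t].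

Lemma feval_cat n (V : lmodType K) (f : n.-tuple B -> V) s t :
  feval f (s ++ t) = feval f s + feval f t.
Proof. by rewrite /feval big_cat. Qed.

Lemma feval_scale n (V : lmodType K) (f : n.-tuple B -> V) c s :
  feval f (fscale c s) = c *: feval f s.
Proof.
by rewrite /feval big_map scaler_sumr; apply: eq_bigr => p _; rewrite scalerA.
Qed.

Lemma feval_mul n (V : lmodType K) (f : n.-tuple B -> V) s t :
  feval f (fmul s t) =
  feval (fun b => feval (fun b' => f [tuple tnth b k * tnth b' k | k < n]) t) s.
Proof.
rewrite /feval /fmul big_allpairs_dep; apply: eq_bigr => p _.
by rewrite scaler_sumr; apply: eq_bigr => q _; rewrite scalerA.
Qed.

Lemma feval_swap n (V : lmodType K) (f : n.-tuple B -> n.-tuple B -> V) s t :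
  feval (fun b => feval (f b) t) s = feval (fun b' => feval (f^~ b') s) t.
Proof.
rewrite /feval (eq_bigr _ (fun p _ => scaler_sumr _ _ _ _)) exchange_big /=.
apply: eq_bigr => q _; rewrite scaler_sumr; apply: eq_bigr => p _.
by rewrite !scalerA mulrC.
Qed.

Lemma multilinear_mul n (V : lmodType K) (f : n.-tuple B -> V) (a : n.-tuple B) :
  multilinear f -> multilinear (fun b => f [tuple tnth a k * tnth b k | k < n]).
Proof.
move=> mf i b c x y.
have e z : [tuple tnth a k * tnth (tset b i z) k | k < n]
           = tset [tuple tnth a k * tnth b k | k < n] i (tnth a i * z).
  apply: eq_from_tnth => k; rewrite !tnth_mktuple; case: eqP => [->|] //.
by rewrite !e mulrDr -scalerAr mf.
Qed.

Lemma multilinear_feval n (V : lmodType K) (f : n.-tuple B -> n.-tuple B -> V) s :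
  (forall b', multilinear (f^~ b')) -> multilinear (fun b => feval (f b) s).
Proof.
move=> mf i b c x y; rewrite /feval scaler_sumr -big_split /=.
by apply: eq_bigr => p _; rewrite mf scalerDr !scalerA mulrC.
Qed.

Lemma mul_tupleC n (a b : n.-tuple B) :
  [tuple tnth a k * tnth b k | k < n] = [tuple tnth b k * tnth a k | k < n].
Proof. by apply: eq_from_tnth => k; rewrite !tnth_mktuple mulrC. Qed.

Definition tzero n : tpow n := tcls [::].
Definition tadd n (x y : tpow n) : tpow n := tcls (trep x ++ trep y).
Definition tscale n (c : K) (x : tpow n) : tpow n := tcls (fscale c (trep x)).
Definition topp n (x : tpow n) : tpow n := tscale (-1) x.
Definition tpure n (b : n.-tuple B) : tpow n := tcls [:: (1, b)].
Definition tone n : tpow n := tpure [tuple 1 | _ < n].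
Definition tmul n (x y : tpow n) : tpow n := tcls (fmul (trep x) (trep y)).

(* The linear map on B^(x)n induced by a multilinear map (and an irrelevant
   function if f is not multilinear). *)
Definition tlift n (V : lmodType K) (f : n.-tuple B -> V) (x : tpow n) : V :=
  feval f (trep x).

Lemma tpow_eq n (x y : tpow n) :
  (forall (V : lmodType K) (f : n.-tuple B -> V),
     multilinear f -> tlift f x = tlift f y) -> x = y.
Proof. by move=> h; rewrite -[x]trepK -[y]trepK; apply/tclsP. Qed.

Section Lift.
Variables (n : nat) (V : lmodType K) (f : n.-tuple B -> V).
Hypothesis mf : multilinear f.

Lemma tlift_cls s : tlift f (tcls s) = feval f s.
Proof. exact: feval_repr. Qed.
Lemma tlift_zero : tlift f (tzero n) = 0.
Proof. by rewrite tlift_cls /feval big_nil. Qed.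
Lemma tlift_add x y : tlift f (tadd x y) = tlift f x + tlift f y.
Proof. by rewrite tlift_cls feval_cat. Qed.
Lemma tlift_scale c x : tlift f (tscale c x) = c *: tlift f x.
Proof. by rewrite tlift_cls feval_scale. Qed.
Lemma tlift_pure b : tlift f (tpure b) = f b.
Proof. by rewrite tlift_cls /feval big_seq1 scale1r. Qed.
Lemma tlift_mul x y :
  tlift f (tmul x y) =
  tlift (fun b => tlift (fun b' => f [tuple tnth b k * tnth b' k | k < n]) y) x.
Proof. by rewrite tlift_cls feval_mul. Qed.
End Lift.

Fact taddA n : associative (@tadd n).
Proof. by move=> x y z; apply: tpow_eq => V f mf; rewrite !tlift_add // addrA. Qed.
Fact taddC n : commutative (@tadd n).
Proof. by move=> x y; apply: tpow_eq => V f mf; rewrite !tlift_add // addrC. Qed.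
Fact tadd0 n : left_id (tzero n) (@tadd n).
Proof.
by move=> x; apply: tpow_eq => V f mf; rewrite tlift_add // tlift_zero // add0r.
Qed.
Fact taddN n : left_inverse (tzero n) (@topp n) (@tadd n).
Proof.
move=> x; apply: tpow_eq => V f mf.
by rewrite tlift_add // tlift_scale // tlift_zero // scaleN1r addNr.
Qed.
HB.instance Definition _ n :=
  GRing.isZmodule.Build (tpow n) (@taddA n) (@taddC n) (@tadd0 n) (@taddN n).

Fact tscaleA n (a b : K) (x : tpow n) : tscale a (tscale b x) = tscale (a * b) x.
Proof. by apply: tpow_eq => V f mf; rewrite !tlift_scale // scalerA. Qed.
Fact tscale1 n : left_id 1 (@tscale n).
Proof. by move=> x; apply: tpow_eq => V f mf; rewrite tlift_scale // scale1r. Qed.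
Fact tscaleDr n : right_distributive (@tscale n) +%R.
Proof.
move=> a x y; apply: tpow_eq => V f mf.
by rewrite !(tlift_add, tlift_scale) // scalerDr.
Qed.
Fact tscaleDl n (x : tpow n) : {morph (@tscale n)^~ x : a b / a + b}.
Proof.
move=> a b; apply: tpow_eq => V f mf.
by rewrite !(tlift_add, tlift_scale) // scalerDl.
Qed.
HB.instance Definition _ n := GRing.Zmodule_isLmodule.Build K (tpow n)
  (@tscaleA n) (@tscale1 n) (@tscaleDr n) (@tscaleDl n).

Fact tmulC n : commutative (@tmul n).
Proof.
move=> x y; apply: tpow_eq => V f mf; rewrite !tlift_mul // /tlift feval_swap.
by congr (feval _ _); apply/funext => b; congr (feval _ _); apply/funext => b';
  rewrite mul_tupleC.
Qed.

Lemma multilinear_mull n (V : lmodType K) (f : n.-tuple B -> V) (y : tpow n) :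
  multilinear f ->
  multilinear (fun b => tlift (fun b' => f [tuple tnth b k * tnth b' k | k < n]) y).
Proof.
move=> mf; apply: multilinear_feval => b' i b c x z.
by rewrite !(mul_tupleC _ b') multilinear_mul.
Qed.

Fact tmulA n : associative (@tmul n).
Proof.
move=> x y z; apply: tpow_eq => V f mf.
rewrite !tlift_mul //; last exact: multilinear_mull.
rewrite /tlift; congr (feval _ _); apply/funext => b.
rewrite -/(tlift _ _) tlift_mul; last exact: multilinear_mul.
rewrite /tlift; congr (feval _ _); apply/funext => b'.
congr (feval _ _); apply/funext => b''; congr f.
by apply: eq_from_tnth => k; rewrite !tnth_mktuple mulrA.
Qed.

Fact tmul1 n : left_id (tone n) (@tmul n).
Proof.
move=> x; apply: tpow_eq => V f mf; rewrite tlift_mul // tlift_pure.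
  rewrite /tlift; congr (feval _ _); apply/funext => b; congr f.
  by apply: eq_from_tnth => k; rewrite !tnth_mktuple mul1r.
exact: multilinear_mull.
Qed.

Fact tmulDl n : left_distributive (@tmul n) +%R.
Proof.
move=> x y z; apply: tpow_eq => V f mf; rewrite !(tlift_mul, tlift_add) //.
exact: multilinear_mull.
Qed.

(* tpow n is not declared as a comAlgType only because that structure requires
   1 != 0; compatibility of its product with scaling is tscaleAl. *)
HB.instance Definition _ n := GRing.Zmodule_isComPzRing.Build (tpow n)
  (@tmulA n) (@tmulC n) (@tmul1 n) (@tmulDl n).

Lemma tscaleAl n (c : K) (x y : tpow n) : c *: (x * y) = (c *: x) * y.
Proof.
apply: tpow_eq => V f mf.
rewrite [LHS]tlift_scale // !tlift_mul // [RHS]tlift_scale //.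
exact: multilinear_mull.
Qed.

Lemma tliftE n (V : lmodType K) (f : n.-tuple B -> V) :
  multilinear f -> linear (tlift f) /\ forall b, tlift f (tpure b) = f b.
Proof.
move=> mf; split=> [c x y|b]; last exact: tlift_pure.
by rewrite [LHS]tlift_add // tlift_scale.
Qed.

Lemma tpow_ind n (x : tpow n) :
  exists s : seq (K * n.-tuple B), x = \sum_(p <- s) p.1 *: tpure p.2.
Proof.
exists (trep x); apply: tpow_eq => V f mf.
transitivity (\sum_(p <- trep x) p.1 *: tlift f (tpure p.2)).
  by apply: eq_bigr => p _; rewrite tlift_pure.
elim: (trep x) => [|p s IH]; first by rewrite !big_nil tlift_zero.
by rewrite !big_cons [RHS]tlift_add // tlift_scale // IH.
Qed.

(* fs_0 (x) ... (x) fs_(n-1) *)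
Definition tmap n (fs : 'I_n -> B -> B) : tpow n -> tpow n :=
  tlift (fun b => tpure [tuple fs k (tnth b k) | k < n]).

Definition tmap2 (f g : B -> B) : tpow 2 -> tpow 2 :=
  tmap (fun k => if k == ord0 then f else g).

(* x (x) y *)
Definition tcat m n (x : tpow m) (y : tpow n) : tpow (m + n) :=
  tlift (fun b => tlift (fun b' => tpure [tuple of b ++ b']) y) x.

(* B^(x)n -> B^(x)n+1, x |-> x (x) 1 *)
Definition tembed n : tpow n -> tpow n.+1 :=
  tlift (fun b => tpure [tuple of rcons b 1]).

Definition tnabla : tpow 2 -> B :=
  tlift (fun b => tnth b ord0 * tnth b ord_max).
Definition tflip : tpow 2 -> tpow 2 :=
  tlift (fun b => tpure [tuple tnth b ord_max; tnth b ord0]).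

End TensorPower.


Section Bialgebra.
Variable K : fieldType.

Definition scalars (A : comAlgType K) : {pred A} :=
  fun a => `[< exists c : K, a = c%:A >].

(* (S, P) is an ordinary Rota-Baxter algebra of weight zero over R; R and S are
   subalgebras of the ambient algebra A. *)
Record ordinary_rba (A : comAlgType K) (R S : {pred A}) (P : A -> A) : Prop := {
  orba_sub : {subset R <= S};
  orba_stable : {in S, forall f, P f \in S};
  orba_add : {in S &, forall f g, P (f + g) = P f + P g};
  orba_scale : {in R & S, forall c f, P (c * f) = c * P f};
  orba_rb : {in S &, forall f g, P f * P g = P (f * P g) + P (P f * g)};
  orba_inj : {in S &, injective P};
  orba_sum : {in S, forall f, exists c g, [/\ c \in R, g \in S & f = c + P g]};
  orba_direct : {in R & S, forall c g, c = P g -> c = 0}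
}.

Definition is_evaluation (A : comAlgType K) (R S : {pred A}) (P E : A -> A) :=
  {in R & S, forall c g, E (c + P g) = c}.

Record bialgebra := Bialgebra {
  bcar :> comAlgType K;
  cop : bcar -> tpow bcar 2;
  cou : bcar -> K;
  cop_linear : linear cop;
  cop_alg : monoid_morphism cop;
  cou_linear : scalar cou;
  cou_alg : monoid_morphism cou;
  cop_assoc : forall b,
    (tlift (fun t => tcat (cop (tnth t ord0)) (tpure [tuple tnth t ord_max]))
       (cop b) : tpow bcar 3)
    = tlift (fun t => tcat (tpure [tuple tnth t ord0]) (cop (tnth t ord_max)))
       (cop b);
  cou_left : forall b,
    tlift (fun t => cou (tnth t ord0) *: tnth t ord_max) (cop b) = b;
  cou_right : forall b,
    tlift (fun t => cou (tnth t ord_max) *: tnth t ord0) (cop b) = b;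
  cop_cocomm : forall b, tflip (cop b) = cop b
}.

Definition eproj (B : bialgebra) (b : B) : B := (cou b)%:A.

Definition convolution (B : bialgebra) (f g : B -> B) (b : B) : B :=
  tnabla (tmap2 f g (cop b)).

Record is_bialgebra_endo (B : bialgebra) (f : B -> B) : Prop := {
  bendo_linear : linear f;
  bendo_alg : monoid_morphism f;
  bendo_cop : forall b, cop (f b) = tmap2 f f (cop b);
  bendo_cou : forall b, cou (f b) = cou b
}.

(* Iterated coproduct B -> B^(x)n; it starts from the counit at n = 0, so that
   it is the identity at n = 1 and cop at n = 2 by the counit axioms. *)
Fixpoint itercop (B : bialgebra) (n : nat) : B -> tpow B n :=
  if n is m.+1 then fun b =>
    tlift (fun t => tcat (tpure [tuple tnth t ord0])
                         (itercop m (tnth t ord_max))) (cop b)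
  else fun b => cou b *: tone B 0.

Record is_rb_bialgebra (B : bialgebra) (P : B -> B) : Prop := {
  rbb_linear : linear P;
  rbb_ordinary : ordinary_rba (@scalars B) predT P;
  rbb_eval : is_evaluation (@scalars B) predT P (@eproj B);
  rbb_cop : forall b,
    cop (P b) = tmap2 P id (cop b) + tmap2 (@eproj B) id (cop (P b))
}.

Record is_scaling (B : bialgebra) (P : B -> B) (s : K -> B -> B) : Prop := {
  scal_endo : forall c, is_bialgebra_endo (s c);
  scal0 : s 0 =1 @eproj B;
  scal1 : s 1 =1 id;
  scalM : forall c d, s (c * d) =1 s c \o s d;
  scalD : forall c d, s (c + d) =1 convolution (s c) (s d);
  scal_int : forall c, c != 0 -> forall b, P (s c b) = c^-1 *: s c (P b)
}.

Record scaled_rb_bialgebra := ScaledRBBialgebra {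
  srb_bialg :> bialgebra;
  srb_int : srb_bialg -> srb_bialg;
  srb_scal : K -> srb_bialg -> srb_bialg;
  srb_intP : is_rb_bialgebra srb_int;
  srb_scalP : is_scaling srb_int srb_scal
}.

(* The induced hierarchy of B: the operator of x_i on B^(x)n, i < n, and the
   action of a matrix M of size n on B^(x)n. *)
Definition tint (B : scaled_rb_bialgebra) n (i : 'I_n) : tpow B n -> tpow B n :=
  tmap (fun k => if k == i then @srb_int B else id).

Definition trow (B : scaled_rb_bialgebra) n (a : 'rV[K]_n) (b : B) : tpow B n :=
  tmap (fun k => srb_scal (a ord0 k)) (itercop n b).

Definition tact (B : scaled_rb_bialgebra) n (M : 'M[K]_n) :
    tpow B n -> tpow B n :=
  tlift (fun b => \prod_(k < n) trow (row k M) (tnth b k)).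

End Bialgebra.


Section Matrices.
Variable K : fieldType.

Definition infmx := nat -> nat -> K.

Definition finitary (M : infmx) : Prop :=
  exists N, forall r c, (N <= maxn r c)%N -> M r c = (r == c)%:R.

Definition idm : infmx := fun r c => (r == c)%:R.

Definition mulm (M N : infmx) : infmx :=
  fun r c => \sum_(k \in [set: nat]%classic) M r k * N k c.

(* diag(M, I) *)
Definition diagm n (M : 'M[K]_n) : infmx := fun r c =>
  if (insub r : option 'I_n, insub c : option 'I_n) is (Some i, Some j)
  then M i j else (r == c)%:R.

(* diag(I_m, M) *)
Definition shiftm m (M : infmx) : infmx := fun r c =>
  if (r < m)%N || (c < m)%N then (r == c)%:R else M (r - m)%N (c - m)%N.

(* same first n rows as M, further rows as in the identity *)
Definition truncm n (M : infmx) : infmx :=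
  fun r c => if (r < n)%N then M r c else (r == c)%:R.

Definition Emx n : infmx := fun r c => ((r == c) && (r != n))%:R.

Definition dmx i (a : K) : infmx :=
  fun r c => if (r == i) && (c == i) then a else (r == c)%:R.

Definition rowm (a : seq K) : infmx :=
  fun r c => if r == 0%N then a`_c else (r == c)%:R.

(* T_1(e_1) *)
Definition T1e1 : infmx :=
  fun r c => if (r == 0%N) && (c == 1%N) then 1 else (r == c)%:R.

(* L_i(w): w lists the entries below the diagonal in column i, starting in
   row i + 1, and is understood to be continued by zeros. *)
Definition Lmx i (w : seq K) : infmx :=
  fun r c => if (c == i) && (i < r)%N then w`_(r - i.+1)%N else (r == c)%:R.

Definition taum i j : infmx :=
  fun r c => (c == (if r == i then j else if r == j then i else r))%:R.

End Matrices.


Section Hierarchies.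
Variables (K : fieldType) (F : comAlgType K).

(* act M is the endomorphism M^*; only its values at finitary M matter. *)
Variables (act : infmx K -> {lrmorphism F -> F}) (int : nat -> {linear F -> F}).

(* The axioms of a K-hierarchy and of a Rota-Baxter hierarchy for the chain of
   subalgebras H 0, H 1, ... of F, the operators being restricted to the union
   of the chain. *)
Record hierarchy_on (H : nat -> {pred F}) : Prop := {
  hier_alg : forall n, GRing.subalg_closed (H n);
  hier0 : H 0%N =i @scalars K F;
  hier_mono : forall n, {subset H n <= H n.+1};
  act_id : forall n, {in H n, forall f, act (@idm K) f = f};
  act_mul : forall M N, finitary M -> finitary N ->
    forall n, {in H n, forall f, act (mulm M N) f = act N (act M f)};
  act_straight : forall M, finitary M ->
    forall n, {in H n, forall f, act M f = act (truncm n M) f};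
  act_stable : forall n (M : 'M[K]_n),
    {in H n, forall f, act (diagm M) f \in H n};
  act_E : forall n, {in H n.+1, forall f, act (Emx K n) f \in H n}
}.

Record rb_hierarchy_on (H : nat -> {pred F}) : Prop := {
  rbh_hier : hierarchy_on H;
  rbh_rb : forall i n, {in H n &, forall f g,
    int i f * int i g = int i (f * int i g) + int i (int i f * g)};
  rbh_comm : forall i j n, {in H n, forall f, int i (int j f) = int j (int i f)};
  rbh_stable : forall i m, (i < m)%N -> {in H m, forall f, int i f \in H m};
  rbh_shift : forall i m (M : infmx K), (i < m)%N -> finitary M ->
    forall n, {in H n, forall f,
      int i (act (shiftm m M) f) = act (shiftm m M) (int i f)};
  rbh_ordinary : forall n, ordinary_rba (H n) (H n.+1) (int n);
  rbh_eval : forall n, is_evaluation (H n) (H n.+1) (int n) (act (Emx K n));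
  rbh_tau : forall i j, i != j -> forall n, {in H n, forall f,
    act (taum K i j) (int i f) = int j (act (taum K i j) f)};
  rbh_scale : forall c : K, c != 0 -> forall n, {in H n, forall f,
    int 0%N (act (dmx 0%N c) f) = c^-1 *: act (dmx 0%N c) (int 0%N f)};
  rbh_T : forall n, {in H n, forall f,
    int 0%N (act (T1e1 K) f)
    = act (T1e1 K) (int 0%N f) - act (Emx K 0%N) (act (T1e1 K) (int 0%N f))};
  rbh_L : forall (v : seq K) n, {in H n, forall f,
    let h := int 1%N (act (Lmx 1%N v) f) in
    int 0%N (act (Lmx 0%N (1 :: v)) (int 0%N f))
    = act (Lmx 1%N (map -%R v))
        (act (Lmx 0%N [:: 1]) (int 0%N h) - int 0%N (act (Lmx 0%N [:: 1]) h))}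
}.

(* F itself is the union of the chain. *)
Definition rb_hierarchy (H : nat -> {pred F}) : Prop :=
  rb_hierarchy_on H /\ forall f, exists n, f \in H n.

Definition rb_subhierarchy (H G : nat -> {pred F}) : Prop :=
  rb_hierarchy_on G /\ forall n, {subset G n <= H n}.

(* phi is an isomorphism from the induced hierarchy of B onto G. *)
Record is_induced_iso (B : scaled_rb_bialgebra K) (G : nat -> {pred F})
    (phi : forall n, tpow B n -> F) : Prop := {
  ind_linear : forall n, linear (phi n);
  ind_alg : forall n, monoid_morphism (phi n);
  ind_inj : forall n, injective (phi n);
  ind_im : forall n f, f \in G n <-> exists x, f = phi n x;
  ind_embed : forall n x, phi n.+1 (tembed x) = phi n x;
  ind_int : forall n (i : 'I_n) x, phi n (tint i x) = int i (phi n x);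
  ind_act : forall n (M : 'M[K]_n) x, phi n (tact M x) = act (diagm M) (phi n x)
}.

Definition separated (G : nat -> {pred F}) : Prop :=
  exists (B : scaled_rb_bialgebra K) (phi : forall n, tpow B n -> F),
    is_induced_iso G phi.

Definition admissible (H G : nat -> {pred F}) : Prop :=
  rb_subhierarchy H G /\ separated G.

(* f(x_i) *)
Definition at_var i (f : F) : F := act (taum K 0%N i) f.

(* gam j mu is g{j}_mu. *)
Definition tensor_expansion (G : nat -> {pred F}) n (g : F) r
    (gam : 'I_n -> 'I_r -> F) : Prop :=
  (forall j mu, exists2 f, f \in G 1%N & gam j mu = at_var j f) /\
  g = \sum_(mu < r) \prod_(j < n) gam j mu.

End Hierarchies.

(* Main.v *)
From HB Require Import structures.
Require Import Defs.
From mathcomp Require Import all_boot all_order all_algebra.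
From mathcomp Require Import boolp classical_sets fsbigop zify.

Set Implicit Arguments.
Unset Strict Implicit.
Unset Printing Implicit Defensive.

Import GRing.Theory.
Local Open Scope ring_scope.

(** In the language of functions the claim is integration by substitution.
    Write x for the vector of variables, so that M^* f is x |-> f (M x).
    Splitting off L_i(l) clears column j of M below row i: in M = L_i(l) Mt
    the variable x_j occurs in row i of Mt only, with coefficient c = M_ij.
    The new variable of integration is y = M_i x, whence
    x_j = (y - sum_(k != j) M_ik x_k) / c, and writing g as a function of y
    and of the x_k with k != j is what the tensor expansion of gt achieves:
    g(x_j) is the sum over mu of gamma'_mu times Mt^* (gamma_mu (x_i / c)).

    Three facts carry the proof.
    - [int_indep]: the integral in x_j is linear over all functions that do not
      depend on x_j.  The axioms give this for the last variable only, and
      transpositions move any variable to the last place.  It takes gamma'_mu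
      out of the integral, and it is the whole proof when column j is zero.
    - [int_subst]: if column j of N is c e_i, then the integral in x_j of N^* f
      is c^-1 (1 - E_j^* ) N^* applied to the integral of f in x_i.  After
      transpositions i = j = 0, and then N^* is composed of a scaling of x_0,
      of matrices acting on the other variables, and of one shear T_1(e_1).
    - The decomposition of g(x_j) above is the image of the expansion of gt
      under the substitution of M_i x / c for x_j, which turns the row defining
      gt into the unit row e_j and affects, of the factors of the expansion,
      only those in x_j.

    Expansions exist because in a bialgebra the elements
    1 (x) ... (x) b (x) ... (x) 1 arise from b (x) 1 (x) ... (x) 1 by matrices
    whose first row is a unit row: this is what the counit axioms say
    ([phi_tsingle]).  The tensor power is spanned by products of such elements. *)

(** * Products of sparse infinite matrices *)

Section MatrixCalculus.
Variable K : fieldType.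
Implicit Types M N : infmx K.

Lemma mulmE b M N r c : (forall k, (b <= k)%N -> M r k * N k c = 0) ->
  mulm M N r c = \sum_(0 <= k < b) M r k * N k c.
Proof.
move=> h; rewrite /mulm (fsbigE (index_iota 0 b)) ?iota_uniq //.
  by under eq_bigl do rewrite in_setT.
by move=> k _; rewrite mem_index_iota /= -leqNgt; exact: h.
Qed.

Lemma sum_delta b s (F : nat -> K) : (s < b)%N ->
  \sum_(0 <= k < b) (k == s)%:R * F k = F s.
Proof.
move=> sb; rewrite big_mkord (bigD1 (Ordinal sb)) //= eqxx mul1r big1 ?addr0 //.
by move=> k; rewrite -val_eqE /= => /negbTE ->; rewrite mul0r.
Qed.

(** All matrices that occur below are factored so that the left factor has rows,
    or the right factor columns, with at most two nonzero entries; the infinite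
    sum defining an entry of the product then has at most two terms. *)
Lemma mulm_row2 M N r s t (a b : K) c :
    (forall k, M r k = a * (k == s)%:R + b * (k == t)%:R) ->
  mulm M N r c = a * N s c + b * N t c.
Proof.
move=> h; rewrite (@mulmE (maxn s t).+1) => [|k]; last first.
  rewrite gtn_max h => /andP[sk tk].
  by rewrite !gtn_eqF // !mulr0 addr0 mul0r.
under eq_bigr do rewrite h mulrDl -!mulrA.
rewrite big_split -!mulr_sumr /= !sum_delta //.
  by rewrite ltnS leq_maxr.
by rewrite ltnS leq_maxl.
Qed.

Lemma mulm_row1 M N r s (a : K) c :
  (forall k, M r k = a * (k == s)%:R) -> mulm M N r c = a * N s c.
Proof.
move=> h; rewrite (@mulm_row2 _ _ _ s s a 0) ?mul0r ?addr0 // => k.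
by rewrite mul0r addr0.
Qed.

Lemma mulm_row M N r s c :
  (forall k, M r k = (k == s)%:R) -> mulm M N r c = N s c.
Proof.
by move=> h; rewrite (@mulm_row1 _ _ _ s 1) ?mul1r // => k; rewrite mul1r.
Qed.

Lemma mulm_col2 M N r s t c (a b : K) :
    (forall k, N k c = a * (k == s)%:R + b * (k == t)%:R) ->
  mulm M N r c = M r s * a + M r t * b.
Proof.
move=> h; rewrite (@mulmE (maxn s t).+1) => [|k]; last first.
  by rewrite gtn_max h => /andP[sk tk]; rewrite !gtn_eqF // !mulr0 addr0 mulr0.
under eq_bigr do rewrite h [_ * (_ + _)]mulrC mulrDl -!mulrA.
rewrite big_split -!mulr_sumr /= !sum_delta ?ltnS ?leq_maxr ?leq_maxl //.
by rewrite mulrC [b * _]mulrC.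
Qed.

Lemma mulm_col M N r s c (a : K) :
  (forall k, N k c = a * (k == s)%:R) -> mulm M N r c = M r s * a.
Proof.
move=> h; rewrite (@mulm_col2 _ _ _ s s _ a 0) ?mulr0 ?addr0 // => k.
by rewrite mul0r addr0.
Qed.

Lemma finitary_mul M N : finitary M -> finitary N -> finitary (mulm M N).
Proof.
move=> [b hM] [d hN]; exists (maxn b d) => r c.
case: (leqP (maxn b d) r) => [br _|rb]; last first.
  rewrite leq_max leqNgt rb /= => cb.
  rewrite (@mulm_col _ _ _ c _ 1) => [|k]; last by rewrite mul1r hN //; lia.
  by rewrite mulr1 hM //; lia.
rewrite (@mulm_row _ _ _ r) => [|k]; first by rewrite hN //; lia.
by rewrite hM 1?eq_sym //; lia.
Qed.

Lemma finitary_diag n (M : 'M[K]_n) : finitary (diagm M).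
Proof.
exists n => r c; rewrite leq_max /diagm => nrc.
by case: insubP => // i; case: insubP => // j cn _ rn; lia.
Qed.

Lemma diagmE n (M : 'M[K]_n) (i j : 'I_n) : diagm M i j = M i j.
Proof. by rewrite /diagm !valK. Qed.

Lemma diagm_row_out n (M : 'M[K]_n) r c : (n <= r)%N -> diagm M r c = (r == c)%:R.
Proof. by move=> nr; rewrite /diagm insubF // ltnNge nr. Qed.

Lemma diagm_col_out n (M : 'M[K]_n) r c : (n <= c)%N -> diagm M r c = (r == c)%:R.
Proof. by move=> nr; rewrite /diagm; case: insub => // i; rewrite insubF // ltnNge nr. Qed.

Lemma finitary_shift m M : finitary M -> finitary (shiftm m M).
Proof.
move=> [b h]; exists (m + b)%N => r c bd; rewrite /shiftm.
case: ifP => // /negbT; rewrite negb_or -!leqNgt => /andP[mr mc].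
by rewrite h; [congr (_%:R); lia|lia].
Qed.

Lemma finitary_E j : finitary (Emx K j).
Proof. by exists j.+1 => r c bd; rewrite /Emx; congr (_%:R); lia. Qed.

Lemma finitary_d (i : nat) (a : K) : finitary (dmx i a).
Proof. by exists i.+1 => r c bd; rewrite /dmx; case: ifP => //; lia. Qed.

Lemma finitary_T : finitary (T1e1 K).
Proof. by exists 2 => r c bd; rewrite /T1e1; case: ifP => //; lia. Qed.

Lemma finitary_L (i : nat) (w : seq K) : finitary (Lmx i w).
Proof.
exists (i.+1 + size w)%N => r c bd; rewrite /Lmx; case: ifP => // /andP[/eqP ci ir].
rewrite nth_default; first by rewrite gtn_eqF ?ci.
by move: (size w) bd => s bd; lia.
Qed.

Lemma finitary_tau (i j : nat) : finitary (taum K i j).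
Proof.
exists (maxn i j).+1 => r c bd; rewrite /taum; congr (_%:R).
by do ![case: eqP => /=]; lia.
Qed.

Definition swapn (i j r : nat) : nat := if r == i then j else if r == j then i else r.

Lemma swapnK i j : involutive (swapn i j).
Proof. by move=> r; rewrite /swapn; do ![case: eqP => /=]; lia. Qed.

Lemma mul_tau_l i j N r c : mulm (taum K i j) N r c = N (swapn i j r) c.
Proof. exact: mulm_row. Qed.

Lemma mul_tau_r i j M r c : mulm M (taum K i j) r c = M r (swapn i j c).
Proof.
rewrite (@mulm_col _ _ _ (swapn i j c) _ 1) ?mulr1 // => k.
by rewrite mul1r /taum -/(swapn i j k) -(inj_eq (can_inj (swapnK i j))) swapnK eq_sym.
Qed.

Lemma mul_E_r j M r c : mulm M (Emx K j) r c = M r c * (c != j)%:R.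
Proof.
rewrite (@mulm_col _ _ _ c _ (c != j)%:R) // => k.
by rewrite /Emx; case: (k =P c) => [->|]; rewrite ?mulr1 ?mulr0.
Qed.

Lemma mul_E_l j N r c : mulm (Emx K j) N r c = (r != j)%:R * N r c.
Proof.
rewrite (@mulm_row1 _ _ _ r (r != j)%:R) // => k.
by rewrite /Emx (eq_sym r k); case: (k =P r) => [_|_]; rewrite ?mulr1 ?mulr0.
Qed.

Lemma mul_L_l (i : nat) (w : seq K) N r c :
  mulm (Lmx i w) N r c
  = N r c + (if (i < r)%N then w`_(r - i.+1) else 0) * N i c.
Proof.
rewrite (@mulm_row2 _ _ _ r i 1 (if (i < r)%N then w`_(r - i.+1) else 0)) ?mul1r //.
move=> k; rewrite /Lmx mul1r (eq_sym r k); case: (k =P i) => [->|_] /=.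
  case: ltngtP => ir; rewrite ?(mulr0, addr0, mul0r, mulr1, add0r) //.
by rewrite mulr0 addr0.
Qed.

Lemma finitary_row (a : seq K) : finitary (rowm a).
Proof.
exists (size a).+1 => r c bd; rewrite /rowm; case: eqP => // r0.
rewrite nth_default; last by move: (size a) bd => s bd; lia.
by rewrite r0; have -> : (0%N == c) = false by lia.
Qed.

End MatrixCalculus.

#[local] Hint Resolve finitary_mul finitary_diag finitary_shift finitary_E
  finitary_d finitary_T finitary_L finitary_tau finitary_row : core.

(** * Substitution in hierarchies *)

Section Hierarchy.
Variables (K : fieldType) (F : comAlgType K) (H : nat -> {pred F}).
Variables (act : infmx K -> {lrmorphism F -> F}) (int : nat -> {linear F -> F}).
Hypothesis hH : rb_hierarchy act int H.
Implicit Types (M N : infmx K) (f u v : F).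

Lemma hier_leq n m : (n <= m)%N -> {subset H n <= H m}.
Proof.
move=> /subnK <-; elim: (m - n)%N => // k IH f /IH.
exact: (hier_mono (rbh_hier hH.1)).
Qed.

Lemma hier_above b f : exists2 m, (b <= m)%N & f \in H m.
Proof.
have [n fn] := hH.2 f; exists (maxn b n); first exact: leq_maxl.
by apply: hier_leq fn; exact: leq_maxr.
Qed.

Lemma actM M N f : finitary M -> finitary N -> act N (act M f) = act (mulm M N) f.
Proof.
by move=> fM fN; have [n fn] := hH.2 f; rewrite (act_mul (rbh_hier hH.1) _ _ fn).
Qed.

(** Straightness in the form used for all matrix identities: factorizations
    need to hold in the rows of the variables that f depends on only, which
    leaves room for auxiliary variables below them. *)
Lemma act_rows m M N f : finitary M -> finitary N -> f \in H m ->
  (forall r c, (r < m)%N -> M r c = N r c) -> act M f = act N f.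
Proof.
move=> fM fN fm eMN.
rewrite (act_straight (rbh_hier hH.1) fM fm) (act_straight (rbh_hier hH.1) fN fm).
congr (act _ f); apply/funext => r; apply/funext => c; rewrite /truncm.
by case: ifP => // /eMN.
Qed.

Lemma act_eq M N f : (forall r c, M r c = N r c) -> act M f = act N f.
Proof. by move=> e; congr (act _ f); apply/funext => r; apply/funext. Qed.

Lemma act1 f : act (@idm K) f = f.
Proof. by have [n fn] := hH.2 f; rewrite (act_id (rbh_hier hH.1) fn). Qed.

Lemma act_tau_diag i f : act (taum K i i) f = f.
Proof.
rewrite -[RHS]act1; apply: act_eq => r c; rewrite /taum /idm eq_sym.
by congr (_ == _)%:R; do ![case: eqP => //].
Qed.

Lemma taumC i j : taum K i j = taum K j i.
Proof.
by apply/funext => r; apply/funext => c; rewrite /taum; congr (_ == _)%:R;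
  do ![case: eqP => //=]; lia.
Qed.

Lemma act_tauK i j f : act (taum K i j) (act (taum K i j) f) = f.
Proof.
rewrite actM //.
rewrite -[RHS]act1; apply: act_eq => r c.
by rewrite mul_tau_l /taum -/(swapn i j _) swapnK /idm eq_sym.
Qed.

Lemma int_tau i j f : act (taum K i j) (int i f) = int j (act (taum K i j) f).
Proof.
have [->|ij] := eqVneq i j.
  by rewrite !act_tau_diag.
by have [n fn] := hH.2 f; rewrite (rbh_tau hH.1 ij fn).
Qed.

(** Invariance under x_j |-> 0 expresses that u does not depend on x_j. *)
Definition indep_of j u := act (Emx K j) u = u.

Lemma indep_prod j (I : finType) (P : pred I) (u : I -> F) :
  (forall k, P k -> indep_of j (u k)) -> indep_of j (\prod_(k | P k) u k).
Proof. by move=> h; rewrite /indep_of rmorph_prod; apply: eq_bigr. Qed.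

Lemma indep_act j M f : finitary M -> (forall r, M r j = 0) -> indep_of j (act M f).
Proof.
move=> fM Mj; rewrite /indep_of actM //.
apply: act_eq => r c; rewrite mul_E_r.
by case: eqP => [->|]; rewrite ?Mj ?mulr0 ?mulr1.
Qed.

Lemma act_E_tau i j f :
  act (taum K i j) (act (Emx K i) f) = act (Emx K j) (act (taum K i j) f).
Proof.
rewrite !actM //.
apply: act_eq => r c; rewrite mul_E_l mul_E_r /taum -/(swapn i j r).
case: (c =P swapn i j r) => [->|_]; rewrite ?(mulr0, mul0r) // mulr1 mul1r; congr (_%:R).
by rewrite /swapn; congr (~~ _); do ![case: eqP => //=]; lia.
Qed.

Lemma act_tau_stable m i j f : (i < m)%N -> (j < m)%N ->
  f \in H m -> act (taum K i j) f \in H m.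
Proof.
move=> im jm fm; pose T : 'M[K]_m := \matrix_(r, c) taum K i j r c.
rewrite (@act_rows m _ (diagm T) _ _ _ fm) //; first exact: (act_stable (rbh_hier hH.1)).
move=> r c rm; case: (ltnP c m) => cm.
  by rewrite -[r]/(nat_of_ord (Ordinal rm)) -[c]/(nat_of_ord (Ordinal cm)) diagmE mxE.
by rewrite diagm_col_out // /taum; congr (_%:R); do ![case: eqP => //=]; lia.
Qed.

(** The axioms say that F_(m+1) with the integral in x_m is a Rota-Baxter algebra
    over F_m.  A function u in F_(m+1) independent of x_j is carried into F_m by
    the transposition of x_j and x_m, so linearity over F_m transports back to
    linearity over u. *)
Lemma int_indep j u f : indep_of j u -> int j (u * f) = u * int j f.
Proof.
move=> uj; have [a ja ua] := hier_above j.+1 u; have [[//|m] am fm] := hier_above a f.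
  by lia.
have jm : (j < m.+1)%N by lia.
have um := hier_leq am ua; set t := act (taum K j m).
have tu : t u \in H m.
  have <- : act (Emx K m) (t u) = t u by rewrite /t -act_E_tau uj.
  apply: (act_E (rbh_hier hH.1)); exact: act_tau_stable.
have tf : t f \in H m.+1 by exact: act_tau_stable.
apply: (can_inj (act_tauK j m)).
rewrite int_tau !rmorphM /= -/t.
by rewrite (orba_scale (rbh_ordinary hH.1 m)) // int_tau.
Qed.

(** The substitution is N : x |-> (c x_0 + a x', N' x') with x' = (x_1, x_2, ...).
    The axioms handle only the shear x_0 |-> x_0 + x_1, so a x' / c is first
    stored in a fresh variable: N is the composite of
      x |-> (x_0, a x' / c, N' x')    which fixes x_0 (the matrix N1 below),
      the shear                       which adds the second entry to the first,
      the removal of the second entry (the matrix S below),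
      the multiplication of x_0 by c.
    The integral in x_0 and the evaluation E_0 commute with the two maps that
    fix x_0, so the factor c^-1 comes from the scaling and 1 - E_0 from the
    shear. *)
Lemma int_subst0 (c : K) N f : c != 0 -> finitary N ->
    (forall r, N r 0%N = (r == 0%N)%:R * c) ->
  let u := act N (int 0%N f) in int 0%N (act N f) = c^-1 *: (u - act (Emx K 0) u).
Proof.
move=> c0 [b hN] Nc /=; have fN : finitary N by exists b.
have [m bm fm] := hier_above b.+1 f.
(* S and N1 act on x_1, x_2, ..., hence every index is shifted by one; beyond
   row m they are continued by the identity to stay finitary. *)
pose S : infmx K := fun r k => ((if (r < m)%N then r.+1 else r) == k)%:R.
pose N1 : infmx K := fun r k =>
  if r == 0%N then N 0%N k.+1 / c else if (r <= m)%N then N r k.+1 else (r == k)%:R.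
have fS : finitary S.
  by exists m.+1 => r k rk; rewrite /S; case: ifP => // rm; congr (_%:R); lia.
have fN1 : finitary N1.
  exists m.+1 => r k rk; rewrite /N1; case: eqP => [r0|r0].
    rewrite r0 hN; last by lia.
    by rewrite mul0r; have -> : (0%N == k) = false by lia.
  by case: ifP => // rm; rewrite hN; [congr (_%:R)|]; lia.
have fT := finitary_T K.
have fd := finitary_d 0 c.
have fS1 := finitary_shift 1 fS.
have fN2 := finitary_shift 1 fN1.
have decomp g : g \in H m ->
    act N g = act (shiftm 1 N1) (act (T1e1 K) (act (shiftm 1 S) (act (dmx 0 c) g))).
  move=> gm; rewrite !actM; auto 10.
  apply: (act_rows _ _ gm) => [//||r k rm]; first by auto 10.
  set P := mulm (T1e1 K) (shiftm 1 N1).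
  have P0 : P 0%N k = N 0%N k / c.
    rewrite /P (@mulm_row2 _ _ _ _ 0%N 1%N 1 1) => [|l]; last first.
      by rewrite !mul1r /T1e1; case: l => [|[|l]] /=; rewrite ?addr0 ?add0r.
    rewrite !mul1r /shiftm /=; case: k => [|k] /=.
      by rewrite addr0 Nc mul1r divff.
    by rewrite add0r /N1 /= subn1.
  have PS l : (l < m)%N -> P l.+2 k = N l.+1 k.
    move=> lm; rewrite /P (@mulm_row _ _ _ _ l.+2) => [|q]; last first.
      by rewrite /T1e1 /= (eq_sym q).
    rewrite /shiftm /=; case: k {P0} => [|k] /=; first by rewrite Nc mul0r.
    by rewrite /N1 !subn1 /= lm.
  have SP l : (l < m)%N -> mulm (shiftm 1 S) P l.+1 k = N l.+1 k.
    move=> lm; rewrite (@mulm_row _ _ _ _ l.+2) ?PS // => -[|q] /=; first by [].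
    by rewrite /shiftm /= /S !subn1 /= lm (eq_sym q.+1).
  case: r rm => [|r] rm.
    rewrite (@mulm_row1 _ _ _ _ 0%N c) => [|[|q]] //=; last first.
    - by rewrite /dmx /= mulr0.
    - by rewrite /dmx /= mulr1.
    rewrite (@mulm_row _ _ _ _ 0%N) => [|q]; last by rewrite /shiftm /= eq_sym.
    by rewrite P0 mulrC divfK.
  rewrite (@mulm_row _ _ _ _ r.+1) => [|q]; last by rewrite /dmx /= eq_sym.
  by rewrite SP //; lia.
have shiftC Q g : finitary Q -> int 0%N (act (shiftm 1 Q) g) = act (shiftm 1 Q) (int 0%N g).
  by move=> fQ; have [n gn] := hH.2 g; rewrite (rbh_shift hH.1 _ fQ gn).
have EC Q g : finitary Q ->
    act (shiftm 1 Q) (act (Emx K 0) g) = act (Emx K 0) (act (shiftm 1 Q) g).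
  move=> fQ; have fQ' := finitary_shift 1 fQ; have fE := finitary_E K 0.
  rewrite !actM //; apply: act_eq => r k; rewrite mul_E_l mul_E_r.
  by case: r k => [|r] [|k] /=; rewrite ?(mulr0, mul0r, mulr1, mul1r).
have im : int 0%N f \in H m by apply: (rbh_stable hH.1); [lia|].
rewrite !decomp // shiftC //.
set g := act (shiftm 1 S) _.
have -> : int 0%N (act (T1e1 K) g)
  = act (T1e1 K) (int 0%N g) - act (Emx K 0%N) (act (T1e1 K) (int 0%N g)).
  by have [n gn] := hH.2 g; rewrite (rbh_T hH.1 gn).
rewrite /g shiftC //.
have -> : int 0%N (act (dmx 0 c) f) = c^-1 *: act (dmx 0 c) (int 0%N f).
  by rewrite (rbh_scale hH.1 c0 fm).
rewrite linearB /= EC // scalerBr.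
by do ![rewrite linearZ /=].
Qed.

(** Renaming x_j to x_0 and x_0 to x_i reduces the rule to the first variable. *)
Lemma int_subst i j (c : K) N f : c != 0 -> finitary N ->
    (forall r, N r j = (r == i)%:R * c) ->
  let u := act N (int i f) in int j (act N f) = c^-1 *: (u - act (Emx K j) u).
Proof.
move=> c0 fN Nc; pose N' := mulm (mulm (taum K 0 i) N) (taum K 0 j).
have fi := finitary_tau K 0 i; have fj := finitary_tau K 0 j.
have fN' : finitary N' by rewrite /N'; auto.
have decomp g : act N g = act (taum K 0 j) (act N' (act (taum K 0 i) g)).
  rewrite !actM; auto 10; apply: act_eq => r k.
  by rewrite !(mul_tau_l, mul_tau_r) /N' !(mul_tau_l, mul_tau_r) !swapnK.
rewrite /= !decomp -int_tau (@int_subst0 c) //= => [|r].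
  by rewrite (taumC 0 i) -int_tau linearZ linearB /= act_E_tau.
rewrite /N' mul_tau_r mul_tau_l {2}/swapn eqxx Nc; congr (_%:R * _); congr nat_of_bool.
by rewrite /swapn; do ![case: eqP => //=]; lia.
Qed.

End Hierarchy.

(** * The decomposition of g(x_j) *)

Section Multiplication.
Variables (K : fieldType) (F : comAlgType K) (H : nat -> {pred F}).
Variables (act : infmx K -> {lrmorphism F -> F}) (int : nat -> {linear F -> F}).
Hypothesis hH : rb_hierarchy act int H.
Implicit Types (M N : infmx K) (f u v : F).

Lemma act_at_var N k f : finitary N -> f \in H 1%N ->
  (forall c, N k c = (k == c)%:R) -> act N (at_var act k f) = at_var act k f.
Proof.
move=> fN f1 Nk; rewrite /at_var (actM hH) //.
apply: (act_rows hH _ _ f1) => [||[|//] c _] //; first by auto.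
by rewrite mul_tau_l /taum /= /swapn eqxx Nk eq_sym.
Qed.

Lemma indep_at_var j k f : k != j -> f \in H 1%N -> indep_of act j (at_var act k f).
Proof. by move=> kj f1; apply: act_at_var => // c; rewrite /Emx kj andbT. Qed.

(** In M = L_i(w) Mt the variable x_j occurs in row i of Mt only.  The rule
    [int_subst] thus applies to Mt once g(x_j) is written as a combination of
    functions in the image of Mt^* whose coefficients are independent of x_j. *)
Lemma int_mul_act M (i n : nat) (j : 'I_n) (w a : seq K) g r (gam : 'I_n -> 'I_r -> F) :
    finitary M -> (forall k, (k < i)%N -> M k j = 0) -> M i j != 0 ->
    (forall k, (i < k)%N -> w`_(k - i.+1) = M k j / M i j) ->
    (forall k, a`_k = if k == j then 1 else - (M i k / M i j)) ->
    g \in H 1%N -> tensor_expansion act H (act (rowm a) g) gam ->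
  let Mt := mulm (Lmx i (map -%R w)) M in
  forall f, int j (at_var act j g * act M f)
    = (M i j)^-1 *: \sum_(mu < r) (\prod_(k < n | k != j) gam k mu) *
       (let u := act Mt (int i
                 (act (taum K i j) (act (dmx j (M i j)^-1) (gam j mu))
                  * act (Lmx i w) f)) in
        u - act (Emx K j) u).
Proof.
move=> fM M0 c0 Mw Ma g1 [hgam gE] Mt f; set c := M i j in c0 Mw Ma *.
have w0 k : (map -%R w)`_k = - w`_k.
  have [kw|kw] := ltnP k (size w); first exact: nth_map.
  by rewrite !nth_default ?oppr0 ?size_map.
have MtE k l : Mt k l = M k l - (if (i < k)%N then M k j / c * M i l else 0).
  rewrite /Mt mul_L_l w0; case: ifP => [ik|_]; last by rewrite mul0r subr0 addr0.
  by rewrite Mw // mulNr.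
have Mtj k : Mt k j = (k == i)%:R * c.
  rewrite MtE; case: ltngtP => ik; rewrite ?mul0r ?mul1r ?subr0.
  - by rewrite divfK // subrr.
  - exact: M0.
  - by rewrite -ik.
have fMt : finitary Mt by rewrite /Mt; auto.
have ME u : act M u = act Mt (act (Lmx i w) u).
  rewrite (actM hH) //; apply: act_eq => k l; rewrite mul_L_l !MtE ltnn subr0.
  by case: ifP => [ik|_]; rewrite ?mul0r ?subr0 ?addr0 // Mw // subrK.
(* R substitutes M_i x / c for x_j; applied to the expansion of the function
   obtained from g through the row a, it restores g(x_j). *)
pose R : infmx K := fun k l => if k == j then M i l / c else (k == l)%:R.
have fR : finitary R.
  have [b hM] := fM; exists (maxn b (maxn i j).+1) => k l bd; rewrite /R.
  case: (k =P j :> nat) => // kj; rewrite hM; last by lia.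
  have -> : (i == l) = false by lia.
  by rewrite mul0r; have -> : (k == l) = false by lia.
have RE : act R (act (rowm a) g) = at_var act j g.
  rewrite (actM hH) //; apply: (act_rows hH _ _ g1) => [||[|//] l _] //; first by auto.
  rewrite (@mulm_col2 _ _ _ _ l j _ 1 (M i l / c - (j == l :> nat)%:R)).
    rewrite /rowm /= mulr1 !Ma eqxx mul1r /taum /= eq_sym.
    by case: (j =P l :> nat) => [<-|_]; rewrite ?divff // ?subrr ?addr0 // subr0 addNr.
  move=> k; rewrite /R mul1r; case: (k =P j :> nat) => [->|]; rewrite ?mulr0 ?addr0 //.
  by rewrite mulr1 addrC subrK.
have Rk k mu : k != j -> act R (gam k mu) = gam k mu.
  by move=> kj; have [h h1 ->] := hgam k mu; apply: act_at_var => // l; rewrite /R ifN.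
have Rj mu : act R (gam j mu)
    = act Mt (act (taum K i j) (act (dmx j c^-1) (gam j mu))).
  have [h h1 ->] := hgam j mu; rewrite /at_var !(actM hH) //; auto 10.
  apply: (act_rows hH _ _ h1) => [||[|//] l _]; try by auto 10.
  rewrite !mul_tau_l /= {1 2}/swapn /= (@mulm_row1 _ _ _ _ j c^-1) ?mul_tau_l => [|k].
    have -> : swapn i j j = i by rewrite /swapn eqxx; case: eqP.
    by rewrite MtE ltnn subr0 /R eqxx mulrC.
  by rewrite /dmx eqxx /=; case: eqP => kj; rewrite ?mulr1 // mulr0 eq_sym; case: eqP.
rewrite -RE gE rmorph_sum mulr_suml linear_sum scaler_sumr; apply: eq_bigr => mu _.
rewrite (bigD1 j) //= rmorphM rmorph_prod /= (eq_bigr _ (fun k => @Rk k mu)).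
rewrite Rj ME [act Mt _ * \prod_(k < n | _) _]mulrC -mulrA -rmorphM (int_indep hH).
  by rewrite (int_subst hH _ c0 fMt Mtj) scalerAr.
by apply: indep_prod => k kj; have [h h1 ->] := hgam k mu; apply: indep_at_var.
Qed.

End Multiplication.

(** * Tensor powers *)

Section Tensor.
Variables (K : fieldType) (B : comAlgType K).

Lemma eq_tlift n (V : lmodType K) (f g : n.-tuple B -> V) x :
  f =1 g -> tlift f x = tlift g x.
Proof. by move=> /funext ->. Qed.

Lemma linear_scale (V W : lmodType K) (L : V -> W) : linear L ->
  forall c x, L (c *: x) = c *: L x.
Proof. exact: GRing.scalable_linear. Qed.

(** [tlift f] is a linear combination of values of f, so linear maps can be moved
    inside. *)
Lemma linear_tlift n (V W : lmodType K) (L : V -> W) (f : n.-tuple B -> V) x :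
  linear L -> L (tlift f x) = tlift (L \o f) x.
Proof.
move=> linL; pose L' : {linear V -> W} := HB.pack L (GRing.isLinear.Build K V W *:%R L linL).
rewrite -[L]/(L' : V -> W) /tlift /feval linear_sum; apply: eq_bigr => p _.
by rewrite linearZ.
Qed.

Lemma multilinear_tlift m n (V : lmodType K) (f : m.-tuple B -> n.-tuple B -> V) y :
  (forall b', multilinear (f^~ b')) -> multilinear (fun b => tlift (f b) y).
Proof.
move=> mf i b c x z; rewrite /tlift /feval scaler_sumr -big_split /=.
by apply: eq_bigr => p _; rewrite mf scalerDr !scalerA mulrC.
Qed.

Lemma multilinear_tpure n : multilinear (@tpure K B n).
Proof.
move=> i b c x y; apply: tpow_eq => V f mf.
by rewrite [RHS]tlift_add // tlift_scale // !tlift_pure // mf.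
Qed.

(** Concatenation, embedding and slotwise maps of tuples are all of this form. *)
Lemma multilinear_map m n (V : lmodType K) (f : n.-tuple B -> V)
    (h : m.-tuple B -> n.-tuple B) (s : 'I_m -> 'I_n) (e : 'I_m -> B -> B) :
    multilinear f -> (forall i, linear (e i)) ->
    (forall i b x, h (tset b i x) = tset (h b) (s i) (e i x)) ->
  multilinear (f \o h).
Proof. by move=> mf le hs i b c x y; rewrite /= !hs le mf. Qed.

Lemma multilinear_tmap n (fs : 'I_n -> B -> B) : (forall k, linear (fs k)) ->
  multilinear (fun b => @tpure K B n [tuple fs k (tnth b k) | k < n]).
Proof.
move=> lfs; apply: (@multilinear_map n n _ _ _ id fs (@multilinear_tpure n)) => // i b x.
by apply: eq_from_tnth => k; rewrite !tnth_mktuple; case: eqP => // ->.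
Qed.

Lemma tmap_linear n (fs : 'I_n -> B -> B) :
  (forall k, linear (fs k)) -> linear (@tmap K B n fs).
Proof. by move=> lfs; apply: (tliftE _).1; exact: multilinear_tmap. Qed.

Lemma tmap_pure n (fs : 'I_n -> B -> B) b : (forall k, linear (fs k)) ->
  tmap fs (@tpure K B n b) = tpure [tuple fs k (tnth b k) | k < n].
Proof. by move=> lfs; apply: tlift_pure; exact: multilinear_tmap. Qed.

Lemma multilinear_catr m n (a : m.-tuple B) :
  multilinear (fun b : n.-tuple B => @tpure K B (m + n) [tuple of a ++ b]).
Proof.
apply: (@multilinear_map n (m + n) _ _ _ (@rshift m n) (fun _ => id)
          (@multilinear_tpure _)) => // i b x.
apply: eq_from_tnth => k; rewrite -[k]splitK; case: (split k) => l /=.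
  by rewrite !tnth_lshift tnth_mktuple eq_lrshift tnth_lshift.
by rewrite !tnth_rshift !tnth_mktuple eq_rshift tnth_rshift.
Qed.

Lemma multilinear_catl m n (a : n.-tuple B) :
  multilinear (fun b : m.-tuple B => @tpure K B (m + n) [tuple of b ++ a]).
Proof.
apply: (@multilinear_map m (m + n) _ _ _ (@lshift m n) (fun _ => id)
          (@multilinear_tpure _)) => // i b x.
apply: eq_from_tnth => k; rewrite -[k]splitK; case: (split k) => l /=.
  by rewrite !tnth_lshift !tnth_mktuple eq_lshift tnth_lshift.
by rewrite !tnth_rshift !tnth_mktuple eq_rlshift tnth_rshift.
Qed.

Lemma tcat_purel m n (a : m.-tuple B) (y : tpow B n) :
  tcat (tpure a) y = tlift (fun b => @tpure K B (m + n) [tuple of a ++ b]) y.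
Proof.
rewrite /tcat tlift_pure //; apply: multilinear_tlift => b'; exact: multilinear_catl.
Qed.

Lemma tcat_pure m n (a : m.-tuple B) (b : n.-tuple B) :
  tcat (tpure a) (tpure b) = @tpure K B (m + n) [tuple of a ++ b].
Proof. by rewrite tcat_purel tlift_pure //; exact: multilinear_catr. Qed.

Lemma tcat_linear m n (a : m.-tuple B) : linear (@tcat K B m n (tpure a)).
Proof.
move=> c x y; rewrite !tcat_purel.
exact: ((tliftE (@multilinear_catr m n a)).1 c x y).
Qed.

Lemma multilinear2 (V : lmodType K) (g : B -> B -> V) :
  (forall x, linear (g x)) -> (forall y, linear (g^~ y)) ->
  multilinear (fun t : 2.-tuple B => g (tnth t ord0) (tnth t ord_max)).
Proof.
move=> gr gl i b c x y; rewrite !tnth_mktuple.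
case: (unliftP ord0 i) => [j|] ->; last by rewrite /= gl.
by rewrite [j]ord1 /= gr.
Qed.

Lemma linear_pure1 : linear (fun x : B => @tpure K B 1 [tuple x]).
Proof.
move=> c x y; have e z : [tuple z] = tset [tuple x] ord0 z.
  by apply: eq_from_tnth => k; rewrite tnth_mktuple [k]ord1.
by rewrite (e (c *: x + y)) (e y) {2}(e x) multilinear_tpure.
Qed.

Lemma tcat1_linear n (y : tpow B n) : linear (fun x : B => @tcat K B 1 n (tpure [tuple x]) y).
Proof.
rewrite /tcat; apply: (_ : linear ((@tlift K B 1 _ _) \o (fun x => tpure [tuple x]))).
move=> c x z /=; rewrite linear_pure1.
by apply: (tliftE _).1; apply: multilinear_tlift => b'; exact: multilinear_catl.
Qed.

(** The inductive step for maps acting slotwise on an iterated coproduct, which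
    is built by prepending one slot at a time. *)
Lemma tmap_tcat1 n (fs : 'I_n.+1 -> B -> B) (x : B) (y : tpow B n) :
    (forall k, linear (fs k)) ->
  tmap fs (tcat (tpure [tuple x]) y : tpow B n.+1)
  = tcat (tpure [tuple fs ord0 x]) (tmap (fun k => fs (lift ord0 k)) y).
Proof.
move=> lfs; rewrite tcat_purel linear_tlift; last exact: tmap_linear.
rewrite [tmap _ y]/tmap linear_tlift; last exact: tcat_linear.
apply: eq_tlift => b /=; rewrite tcat_pure [LHS]tmap_pure //; congr tpure.
apply: eq_from_tnth => k; rewrite tnth_mktuple.
case: (unliftP ord0 k) => [j|] -> //.
transitivity (fs (lift ord0 j) (tnth b j)).
  by congr (fs _ _); rewrite !(tnth_nth 0).
apply/esym; rewrite [LHS](tnth_nth 0) /= add0n.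
by rewrite -(tnth_mktuple (fun l => fs (lift ord0 l) (tnth b l)) j) [RHS](tnth_nth 0).
Qed.

Lemma tpure_mul n (a b : n.-tuple B) :
  tpure a * tpure b = @tpure K B n [tuple tnth a k * tnth b k | k < n].
Proof.
apply: tpow_eq => V f mf; rewrite [LHS]tlift_mul //.
rewrite tlift_pure; last exact: multilinear_mull.
by rewrite !tlift_pure //; exact: multilinear_mul.
Qed.

(** 1 (x) ... (x) x (x) ... (x) 1 with x in slot k, up to [tpure]. *)
Definition tsingle n (k : 'I_n) (x : B) : n.-tuple B := tset [tuple 1 | _ < n] k x.

Lemma tsingle_linear n (k : 'I_n) : linear (fun x => @tpure K B n (tsingle k x)).
Proof. by move=> c x y; rewrite multilinear_tpure. Qed.

Lemma tpure_prod n (b : n.-tuple B) :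
  @tpure K B n b = \prod_(k < n) tpure (tsingle k (tnth b k)).
Proof.
have prodE (s : seq 'I_n) (u : 'I_n -> n.-tuple B) : \prod_(k <- s) @tpure K B n (u k)
    = tpure [tuple \prod_(k <- s) tnth (u k) l | l < n].
  elim: s => [|k s IH]; first rewrite big_nil; rewrite ?big_cons ?IH ?tpure_mul;
    by congr tpure; apply: eq_from_tnth => l; rewrite !tnth_mktuple ?big_nil ?big_cons.
rewrite -big_enum prodE; congr tpure; apply: eq_from_tnth => l.
rewrite tnth_mktuple big_enum (bigD1 l) //= tnth_mktuple eqxx.
rewrite big1 ?mulr1 // => k kl; rewrite !tnth_mktuple eq_sym; case: eqP kl => //.
Qed.

Lemma tnth_rcons n (b : n.-tuple B) (y : B) (k : 'I_n.+1) :
  tnth [tuple of rcons b y] k = oapp (tnth b) y (insub (k : nat)).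
Proof.
rewrite (tnth_nth y) /= nth_rcons size_tuple; case: insubP => [j kn <-|/negbTE->] /=.
  by rewrite ltn_ord -tnth_nth.
exact: if_same.
Qed.

Lemma rcons_tset n (b : n.-tuple B) (i : 'I_n) (x y : B) :
  [tuple of rcons (tset b i x) y]
  = tset [tuple of rcons b y] (widen_ord (leqnSn n) i) x.
Proof.
apply: eq_from_tnth => k; rewrite tnth_mktuple !tnth_rcons -val_eqE /=.
case: insubP => [j kn <-|] /=; first by rewrite tnth_mktuple.
by case: eqP => // -> /negP; case.
Qed.

Lemma tembed_pure n (b : n.-tuple B) :
  tembed (tpure b) = @tpure K B n.+1 [tuple of rcons b 1].
Proof.
apply: tlift_pure.
apply: (@multilinear_map n n.+1 _ _ _ (widen_ord (leqnSn n)) (fun _ => id)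
          (@multilinear_tpure _)) => // i c x; exact: rcons_tset.
Qed.

Lemma tembed_tsingle n (k : 'I_n) (x : B) :
  tembed (tpure (tsingle k x)) = @tpure K B n.+1 (tsingle (widen_ord (leqnSn n) k) x).
Proof.
rewrite tembed_pure rcons_tset; congr (tpure (tset _ _ _)).
apply: eq_from_tnth => l; rewrite tnth_rcons tnth_mktuple.
by case: insubP => //= j _ _; rewrite tnth_mktuple.
Qed.

End Tensor.

(** * Iterated coproducts and the matrix action *)

Section Bialgebra.
Variables (K : fieldType) (B : scaled_rb_bialgebra K).

Lemma eproj_linear : linear (@eproj K B).
Proof.
by move=> c x y; rewrite /eproj (@cou_linear K B) scalerDl scalerA.
Qed.

Lemma scal_linear c : linear (@srb_scal K B c).
Proof. exact: bendo_linear (scal_endo (srb_scalP B) c). Qed.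

Lemma itercop_linear n : linear (@itercop K B n).
Proof.
elim: n => [|n IH] c x y /=; first by rewrite (@cou_linear K B) scalerDl scalerA.
rewrite cop_linear.
apply: (tliftE (multilinear2 (g := fun x y => tcat (tpure [tuple x]) (itercop n y)) _ _)).1.
- by move=> z d u v; rewrite IH tcat_linear.
- by move=> z; exact: tcat1_linear.
Qed.

Lemma itercop1 n : @itercop K B n 1 = 1.
Proof.
elim: n => [|n IH] /=; first by rewrite (cou_alg B).1 scale1r.
rewrite (cop_alg B).1 [X in tlift _ X]/(tpure _) tlift_pure; last first.
  apply: (multilinear2 (g := fun x y => tcat (tpure [tuple x]) (itercop n y))).
  - by move=> z d u v; rewrite itercop_linear tcat_linear.
  - by move=> z; exact: tcat1_linear.
rewrite !tnth_mktuple IH tcat_pure; congr tpure.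
by apply: eq_from_tnth => k; rewrite tnth_mktuple; case: (unliftP ord0 k) => [j|] ->;
  rewrite !(tnth_nth 0) //= -[LHS]/(nth 0 [tuple 1 | _ < n] j) -tnth_nth tnth_mktuple.
Qed.

Lemma trow_linear n (a : 'rV[K]_n) : linear (@trow K B n a).
Proof.
move=> c x y; rewrite /trow itercop_linear; apply: tmap_linear => k.
exact: scal_linear.
Qed.

Lemma trow1 n (a : 'rV[K]_n) : trow a (1 : B) = 1.
Proof.
rewrite /trow itercop1 tmap_pure => [|k]; last exact: scal_linear.
congr tpure; apply: eq_from_tnth => k; rewrite !tnth_mktuple.
exact: (bendo_alg (scal_endo (srb_scalP B) _)).1.
Qed.

Lemma tsingle_cou_right n (k : 'I_n) (b : B) : tpure (tsingle k b)
  = tlift (fun t => cou (tnth t ord_max) *: tpure (tsingle k (tnth t ord0))) (cop b).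
Proof.
rewrite -[X in tsingle k X](cou_right b).
have := @linear_tlift _ _ 2 _ _ (fun x => tpure (tsingle k x))
  (fun t => cou (tnth t ord_max) *: tnth t ord0) (cop b) (@tsingle_linear _ _ n k).
by move=> /= ->; apply: eq_tlift => t; rewrite /= (linear_scale (@tsingle_linear _ _ n k)).
Qed.

Lemma tsingle_cou_left n (k : 'I_n) (b : B) : tpure (tsingle k b)
  = tlift (fun t => cou (tnth t ord0) *: tpure (tsingle k (tnth t ord_max))) (cop b).
Proof.
rewrite -[X in tsingle k X](cou_left b).
have := @linear_tlift _ _ 2 _ _ (fun x => tpure (tsingle k x))
  (fun t => cou (tnth t ord0) *: tnth t ord_max) (cop b) (@tsingle_linear _ _ n k).
by move=> /= ->; apply: eq_tlift => t; rewrite /= (linear_scale (@tsingle_linear _ _ n k)).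
Qed.

(** Each step of the iterated coproduct splits off a first factor, which the left
    counit axiom removes; the right counit axiom enters once, for the innermost
    coproduct, whose right factor is the counit itself. *)
Lemma itercop_counit n b :
  tmap (fun k : 'I_n.+1 => if k == ord_max then id else @eproj K B) (itercop n.+1 b)
  = tpure (tsingle ord_max b).
Proof.
have lfs m (k : 'I_m.+1) : linear (if k == ord_max then id else @eproj K B).
  by case: eqP => _ //; exact: eproj_linear.
elim: n b => [|n IH] b; rewrite linear_tlift; try exact: tmap_linear.
  rewrite tsingle_cou_right.
  apply: eq_tlift => t /=; rewrite tmap_tcat1 // (linear_scale (tmap_linear _)) //.
  rewrite [LHS](linear_scale (tcat_linear _)).
  congr (_ *: _); rewrite tmap_pure // tcat_pure; congr tpure.
  by apply: eq_from_tnth => k; rewrite [k]ord1 !(tnth_nth 0) /= enum_ordSl.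
rewrite tsingle_cou_left.
apply: eq_tlift => t /=; rewrite tmap_tcat1 //=.
have -> : (fun k : 'I_n.+1 => if lift ord0 k == ord_max then id else @eproj K B)
   = (fun k => if k == ord_max then id else @eproj K B).
  by apply/funext => k; rewrite -!val_eqE.
rewrite IH /eproj.
rewrite [LHS](linear_scale (tcat1_linear _)); congr (_ *: _).
rewrite tcat_pure; congr tpure; apply: eq_from_tnth => k.
rewrite tnth_mktuple; case: (unliftP ord0 k) => [j|] -> /=.
  rewrite [LHS](tnth_nth 0) /= -[LHS]/(nth 0 (tsingle ord_max (tnth t ord_max)) j) -tnth_nth.
  by rewrite !tnth_mktuple -!val_eqE.
by rewrite [LHS](tnth_nth 0) /= tnth_mktuple.
Qed.

Lemma multilinear_tact n (M : 'M[K]_n) :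
  multilinear (fun b : n.-tuple B => \prod_(k < n) trow (row k M) (tnth b k)).
Proof.
move=> i b c x y.
have e z : \prod_(k < n) trow (row k M) (tnth (tset b i z) k)
    = trow (row i M) z * \prod_(k < n | k != i) trow (row k M) (tnth b k).
  rewrite (bigD1 i) //= tnth_mktuple eqxx; congr (_ * _).
  by apply: eq_bigr => k /negbTE ki; rewrite tnth_mktuple ki.
by rewrite !e trow_linear mulrDl -tscaleAl.
Qed.

(** A unit row scales all factors of the iterated coproduct but one by 0^*, which
    is the counit; the other rows of M act on the factors 1, which they fix. *)
Lemma tact_last n (M : 'M[K]_n.+1) b : row ord0 M = delta_mx ord0 ord_max ->
  @tact K B _ M (tpure (tsingle ord0 b)) = tpure (tsingle ord_max b).
Proof.
move=> M0; rewrite /tact tlift_pure; last exact: multilinear_tact.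
rewrite (bigD1 ord0) //= [X in _ * X]big1 ?mulr1 => [|k k0]; last first.
  by rewrite !tnth_mktuple (negbTE k0) trow1.
rewrite tnth_mktuple eqxx M0 -itercop_counit /trow; congr (tmap _ _).
apply/funext => k; rewrite mxE eqxx /=; case: eqP => _; apply/funext => x.
  exact: scal1 (srb_scalP B) _.
exact: scal0 (srb_scalP B) _.
Qed.

End Bialgebra.

(** * Tensor expansions in separated hierarchies *)

Section Separated.
Variables (K : fieldType) (F : comAlgType K) (H G : nat -> {pred F}).
Variables (act : infmx K -> {lrmorphism F -> F}) (int : nat -> {linear F -> F}).
Hypothesis hH : rb_hierarchy act int H.
Hypothesis GH : forall n, {subset G n <= H n}.
Variables (B : scaled_rb_bialgebra K) (phi : forall n, tpow B n -> F).
Hypothesis phiP : is_induced_iso act int G phi.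

(** By the embedding axiom it suffices to treat the last slot; b in the last slot
    is obtained from b in the first by a matrix action, which on F is f(x_0)
    |-> f(x_k), since only the first row of the matrix matters for f in G_1. *)
Lemma phi_tsingle n (k : 'I_n) (b : B) :
  phi (tpure (tsingle k b)) = at_var act k (phi (tpure [tuple b])).
Proof.
elim: n k => [[]//|n IH] k.
have IH' (l : 'I_n) : phi (tpure (tsingle (widen_ord (leqnSn n) l) b))
    = at_var act l (phi (tpure [tuple b])).
  by rewrite -tembed_tsingle (ind_embed phiP) IH.
case: (ltngtP k n) (ltn_ord k) => [kn _|nk|kn _]; first 1 last.
- by rewrite ltnS leqNgt nk.
- case: n => [|n] in k IH IH' kn *.
    rewrite kn /at_var (act_tau_diag hH); congr (phi (tpure _)).
    by apply: eq_from_tnth => l; rewrite tnth_mktuple [l]ord1 [k]ord1.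
  have -> : k = ord_max by apply: val_inj.
  pose M : 'M[K]_n.+2 := \matrix_(r, c) (c == ord_max)%:R.
  rewrite -(@tact_last _ _ _ M); last by apply/rowP => c; rewrite !mxE.
  have := IH' ord0; rewrite /at_var (act_tau_diag hH) => phi0.
  have -> : ord0 = widen_ord (leqnSn n.+1) ord0 :> 'I_n.+2 by apply: val_inj.
  rewrite (ind_act phiP) phi0; apply: (act_rows hH (m := 1)) => //.
    by apply: GH; apply/(ind_im phiP); exists (tpure [tuple b]).
  case=> // c _; rewrite /taum /=; case: (ltnP c n.+2) => cn; last first.
    by rewrite diagm_col_out // ; congr (_%:R); lia.
  rewrite -[c]/(nat_of_ord (Ordinal cn)) -[0%N]/(nat_of_ord (@ord0 n.+1)) diagmE mxE.
  by rewrite -val_eqE.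
have -> : k = widen_ord (leqnSn n) (Ordinal kn) by apply: val_inj.
exact: IH'.
Qed.

(** A pure tensor is the product of its factors, each placed in its slot, which
    [phi_tsingle] carries to functions of one variable; the scalars of a formal
    sum of pure tensors are absorbed in slot j. *)
Lemma separated_expansion n (j : 'I_n) g : g \in G n ->
  exists r (gam : 'I_n -> 'I_r -> F), tensor_expansion act G g gam.
Proof.
move=> /(ind_im phiP)[x ->]; have [s ->] := tpow_ind x.
pose p mu := nth (0, [tuple 0 | _ < n]) s mu.
exists (size s), (fun (k : 'I_n) (mu : 'I_(size s)) => at_var act k
  (phi (tpure [tuple (if k == j then (p mu).1 else 1) *: tnth (p mu).2 k]))).
split=> [k mu|].
  by eexists; [apply/(ind_im phiP); eexists; reflexivity | reflexivity].
pose phi' : {linear tpow B n -> F} :=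
  HB.pack (@phi n) (GRing.isLinear.Build K _ _ *:%R (@phi n) (ind_linear phiP (n:=n))).
rewrite -[LHS]/(phi' _) linear_sum (big_nth (0, [tuple 0 | _ < n])) big_mkord.
apply: eq_bigr => mu _; rewrite -/(p mu).
have phiM (u : 'I_n -> tpow B n) (P : pred 'I_n) :
    phi (\prod_(k | P k) u k) = \prod_(k | P k) phi (u k).
  apply: (big_morph (@phi n)); [exact: (ind_alg phiP n).2 | exact: (ind_alg phiP n).1].
rewrite linearZ /= tpure_prod phiM (bigD1 j) //= [in RHS](bigD1 j) //= eqxx scalerAl.
congr (_ * _).
  rewrite phi_tsingle /at_var (linear_scale (@linear_pure1 _ _)).
  rewrite (linear_scale (ind_linear phiP (n := 1))) /=.
  by rewrite linearZ.
by apply: eq_bigr => k /negbTE ->; rewrite phi_tsingle scale1r.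
Qed.

End Separated.

(** * The transformation rule for integrals *)

Theorem proposition4p2 (K : fieldType) (charK : [pchar K] =i pred0)
    (F : comAlgType K) (H : nat -> {pred F})
    (act : infmx K -> {lrmorphism F -> F}) (int : nat -> {linear F -> F})
    (hH : rb_hierarchy act int H)
    (G : nat -> {pred F}) (hG : admissible act int H G)
    (n : nat) (M : 'M[K]_n) (j : 'I_n) (g : F) (hg : g \in G 1%N) :
  (forall i : 'I_n, M i j != 0 -> (forall k : 'I_n, (k < i)%N -> M k j = 0) ->
    let l := drop i.+1 [seq M k j / M i j | k <- enum 'I_n] in
    let Mt := mulm (Lmx i (map -%R l)) (diagm M) in
    let gt := act (rowm [seq (if k == j then 1 else - (M i k / M i j))
                        | k <- enum 'I_n]) g in
    [/\ gt \in G n,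
        exists r (gam : 'I_n -> 'I_r -> F), tensor_expansion act G gt gam
      & forall r (gam : 'I_n -> 'I_r -> F), tensor_expansion act G gt gam ->
        forall f : F,
          int j (at_var act j g * act (diagm M) f)
          = (M i j)^-1 *:
            \sum_(mu < r)
              (\prod_(k < n | k != j) gam k mu) *
              (let u := act Mt (int i
                 (act (taum K i j) (act (dmx j (M i j)^-1) (gam j mu))
                  * act (Lmx i l) f)) in
               u - act (Emx K j) u)])
  /\ ((forall k : 'I_n, M k j = 0) ->
      forall f : F,
        int j (at_var act j g * act (diagm M) f)
        = int j (at_var act j g) * act (diagm M) f).
Proof.
have [[rbG GH] [B [phi phiP]]] := hG.
have g1 : g \in H 1%N by exact: GH.
have colM k : diagm M k j = if insub k is Some k' then M k' j else 0.
  case: insubP => [k' _ <-|]; first by rewrite diagmE.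
  by rewrite -leqNgt => nk; rewrite diagm_row_out // gtn_eqF // (leq_trans _ nk).
have nth_row (u : 'I_n -> K) k :
    [seq u c | c <- enum 'I_n]`_k = if insub k is Some k' then u k' else 0.
  case: insubP => [k1 _ <-|].
    by rewrite (nth_map j) ?nth_ord_enum // size_enum_ord; exact: ltn_ord.
  by rewrite -leqNgt => nk; rewrite nth_default // size_map size_enum_ord.
split=> [i c0 M0 l Mt gt|M0 f]; last first.
  rewrite mulrC (int_indep hH) 1?mulrC //; apply: (indep_act hH) => // r.
  by rewrite colM; case: insub.
have gtn : gt \in G n.
  pose a := [seq (if k == j then 1 else - (M i k / M i j)) | k <- enum 'I_n].
  pose A : 'M[K]_n := \matrix_(r, c) rowm a r c.
  have gn : g \in G n.
    case: n {M colM nth_row i c0 M0 l Mt gt a A} j => [[]//|n] _.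
    elim: n => // n IH; exact: (hier_mono (rbh_hier rbG)).
  have -> : gt = act (diagm A) g.
    apply: (act_eq _) => r c; rewrite /diagm.
    case: (insubP _ r) => [r' _ <-|nr]; first case: (insubP _ c) => [c' _ <-|nc].
    - by rewrite mxE.
    - rewrite /rowm; case: eqP => // r0; rewrite nth_row insubN // r0.
      by case: c nc => //; rewrite (leq_ltn_trans _ (ltn_ord j)).
    - by rewrite /rowm; case: eqP nr => // ->; rewrite (leq_ltn_trans _ (ltn_ord j)).
  exact: (act_stable (rbh_hier rbG)).
split=> // [|r gam [hgam gE] f]; first exact: (separated_expansion hH GH phiP j).
have gamH : tensor_expansion act H gt gam.
  by split=> // k mu; have [h h1 ->] := hgam k mu; exists h => //; exact: GH.
rewrite -[M i j]diagmE; apply: (int_mul_act hH _ _ _ _ _ g1 gamH) => //.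
- by move=> k ki; rewrite colM; case: insubP => // k' _ k'k; apply: M0; rewrite k'k.
- by rewrite diagmE.
- move=> k ik; rewrite nth_drop subnKC // nth_row colM.
  by case: insub => [k'|]; rewrite ?diagmE ?mul0r.
move=> k; rewrite nth_row; case: insubP => [k' _ <-|nk]; first by rewrite !diagmE.
rewrite ifN; last by apply: contraNneq nk => ->; exact: ltn_ord.
have {}nk : (n <= k)%N by rewrite leqNgt.
rewrite diagm_col_out // ltn_eqF ?mul0r ?oppr0 //.
exact: leq_trans (ltn_ord i) nk.
Qed.
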